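(* Let $f,g_i:\mathbb R^n\to\mathbb R\cup\{+\infty\}$ ($i\in I=\{1,\dots,m\}$), $p>0$, $q>0$, and let $\bar x\in\bigcap_{i=1}^m\mathrm{dom}\,g_i\cap\mathrm{dom}\,f$. For $r>0$ let $\ell_p(x)=f(x)+r\sum_{i=1}^m(g_i^+)^p(x)$. Consider the condition $$( * )\qquad f'_q(\bar x;x)>0\quad\text{for all } x\ne0 \text{ with } (g_i^+)'_{q/p}(\bar x;x)=0,\ i\in I(\bar x).$$ (i) Suppose that $f'_q(\bar x;\cdot)$ is proper and that $( * )$ holds. Then $\bar x$ is a $q$-order sharp minimizer of the penalty problem of minimizing $\ell_p$ for all $r>\rho_0$, where $\rho_0:=-b(\bar x)/a(\bar x)$ if $K^*(\bar x)\ne\emptyset$, and $\rho_0:=0$ otherwise. (ii) Suppose that $f$ is $q$-order Hadamard directionally differentiable at $\bar x$, that $m=1$, and that $\bar x$ is a $q$-order sharp minimizer of the penalty problem of minimizing $\ell_p$ for some $r>0$. Then $( * )$ holds.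
   Context: The underlying problem is: minimize $f(x)$ subject to $g_i(x)\le0$, $i\in I=\{1,\dots,m\}$; its $\ell_p$ penalty problem is: minimize $\ell_p(x)$. Here $\mathrm{dom}\,f=\{x: f(x)<+\infty\}$ (similarly for $g_i$) and $g_i^+(x):=\max\{0,g_i(x)\}$. For $s>0$, $h:\mathbb R^n\to\mathbb R\cup\{+\infty\}$ and $\bar x\in\mathrm{dom}\,h$, the $s$-order Hadamard directional subderivative of $h$ at $\bar x$ is $h'_s(\bar x;x):=\liminf_{u\to x,\,t\downarrow0}\frac{h(\bar x+tu)-h(\bar x)}{t^s}$, $x\in\mathbb R^n$. The function $f'_q(\bar x;\cdot)$ is proper if it never takes the value $-\infty$ and is not identically $+\infty$. The function $f$ is $q$-order Hadamard directionally differentiable at $\bar x$ if the (finite) limit $\lim_{u\to x,\,t\downarrow0}\frac{f(\bar x+tu)-f(\bar x)}{t^q}$ exists for all $x\in\mathbb R^n$. A point $\bar x\in\mathrm{dom}\,h$ is a $q$-order sharp minimizer of a function $h$ (or of the problem of minimizing $h$) if there exist $\tau>0$ and a neighbourhood $U$ of $\bar x$ such that $\tau\|x-\bar x\|^q\le h(x)-h(\bar x)$ for all $x\in U$. Notation: $I(\bar x)=\{i\in I: g_i(\bar x)=0\}$; $K^*(\bar x)=\{x\in\mathbb R^n:\|x\|=1,\ f'_q(\bar x;x)\le0\}$; $a(\bar x)=\min\left\{\sum_{i\in I(\bar x)}\left[(g_i^+)'_{q/p}(\bar x;x)\right]^p : x\in K^*(\bar x)\right\}$; $b(\bar x)=\min\{f'_q(\bar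 x;x):\|x\|=1\}$.
   Formalization: The formal theorem also assumes that x̄ is feasible (g_i(x̄) ≤ 0 for all i) and, in (ii), that if g_1(x̄) < 0 then g_1 ≤ 0 in a neighbourhood of x̄; without these the statement is false. *)

(* Defs.v *)
From HB Require Import structures.
From mathcomp Require Import all_boot all_order all_algebra.
From mathcomp Require Import all_classical all_reals all_analysis.

Set Implicit Arguments.
Unset Strict Implicit.
Unset Printing Implicit Defensive.

Import Order.TTheory GRing.Theory Num.Theory.
Import numFieldNormedType.Exports.

Local Open Scope classical_set_scope.
Local Open Scope ring_scope.
Local Open Scope ereal_scope.

(* The library's norm `|x| on row vectors is the sup norm; the topology is the
   same, but the unit sphere, hence a(xbar) and b(xbar), is not. *)
Definition euclid_norm (R : realType) (n : nat) (x : 'rV[R]_n) : R :=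
  Num.sqrt (\sum_(i < n) x ord0 i ^+ 2)%R.

(* A function into R U {+oo} is a function h into \bar R with -oo < h x for
   all x. *)
Definition eff_domain (R : realType) (n : nat) (h : 'rV[R]_n -> \bar R) :
    set 'rV[R]_n :=
  [set x | h x < +oo].

Definition diff_quotient (R : realType) (n : nat) (s : R)
    (h : 'rV[R]_n -> \bar R) (xbar : 'rV[R]_n) (ut : 'rV[R]_n * R) : \bar R :=
  (h (xbar + ut.2 *: ut.1)%R - h xbar) / (ut.2 `^ s)%:E.

Definition subderivative (R : realType) (n : nat) (s : R)
    (h : 'rV[R]_n -> \bar R) (xbar x : 'rV[R]_n) : \bar R :=
  limf_einf (diff_quotient s h xbar) (filter_prod (nbhs x) (0%R : R)^'+).

Definition proper_fun (R : realType) (n : nat) (h : 'rV[R]_n -> \bar R) : Prop :=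
  (forall x, h x != -oo) /\ (exists x, h x != +oo).

Definition hadamard_differentiable (R : realType) (n : nat) (s : R)
    (h : 'rV[R]_n -> \bar R) (xbar : 'rV[R]_n) : Prop :=
  forall x : 'rV[R]_n, exists l : R,
    diff_quotient s h xbar @ filter_prod (nbhs x) (0%R : R)^'+ --> l%:E.

Definition sharp_minimizer (R : realType) (n : nat) (s : R)
    (h : 'rV[R]_n -> \bar R) (xbar : 'rV[R]_n) : Prop :=
  eff_domain h xbar /\
  exists2 tau : R, (0 < tau)%R &
    \forall x \near xbar,
      (tau * euclid_norm (x - xbar) `^ s)%:E <= h x - h xbar.

Section Penalty.
Variables (R : realType) (n m : nat) (p q : R).
Variables (f : 'rV[R]_n -> \bar R) (g : 'I_m -> 'rV[R]_n -> \bar R).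

Definition penalty (r : R) (x : 'rV[R]_n) : \bar R :=
  f x + r%:E * \sum_(i < m) ((g i)^\+ x) `^ p.

Variable xbar : 'rV[R]_n.

Definition feasible : Prop := forall i, g i xbar <= 0.

Definition active : {set 'I_m} := finset (fun i => g i xbar == 0).

(* Holds in particular if every inactive constraint function is upper
   semicontinuous at xbar. *)
Definition inactive_locally_satisfied : Prop :=
  forall i, g i xbar < 0 -> \forall x \near xbar, g i x <= 0.

Definition qualification : Prop :=
  forall x : 'rV[R]_n, x != 0%R ->
    (forall i, i \in active -> subderivative (q / p) (g i)^\+ xbar x = 0) ->
    0 < subderivative q f xbar x.

Definition Kstar : set 'rV[R]_n :=
  [set x | euclid_norm x = 1%R /\ subderivative q f xbar x <= 0].

(* Subderivatives are lower semicontinuous in the direction, and the unit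
   sphere and Kstar are compact, so under the hypotheses in use the infima
   below are minima whenever the index set is nonempty. *)
Definition a_const : \bar R :=
  ereal_inf [set \sum_(i in active)
                   (subderivative (q / p) (g i)^\+ xbar x) `^ p | x in Kstar].

Definition b_const : \bar R :=
  ereal_inf [set subderivative q f xbar x | x in [set x | euclid_norm x = 1%R]].

(* a_const may be +oo, in which case the quotient is 0. *)
Definition rho0 : \bar R :=
  if `[< Kstar !=set0 >] then - b_const / a_const else 0.

End Penalty.

(* Main.v *)
Require Import Defs.
From mathcomp Require Import all_boot all_order all_algebra.
From mathcomp Require Import all_classical all_reals all_analysis.
From mathcomp Require Import ring lra.

(* For t > 0 the difference quotient of order q of l_p at xbar is exactly the one
   of f plus r times the sum of the p-th powers of the quotients of order q/p of
   the g_i^+, because (t^(q/p))^p = t^q and g_i^+ vanishes at xbar. Superadditivity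
   of lower limits therefore bounds the subderivative of l_p from below by
   f'_q + r * sum_(i active) [(g_i^+)'_(q/p)]^p, which is positive on the unit
   sphere when r > rho0; compactness of the sphere makes this local growth
   uniform in the direction. Conversely, when m = 1 and (g^+)'_(q/p)(x) = 0 there
   are points arbitrarily close to xbar in directions close to x where the penalty
   term is negligible against t^q, so the growth of l_p must come from f, and as
   the quotients of f converge their limit is positive. *)

Set Implicit Arguments.
Unset Strict Implicit.
Unset Printing Implicit Defensive.

Import Order.TTheory GRing.Theory Num.Theory.
Import numFieldNormedType.Exports.

Local Open Scope classical_set_scope.
Local Open Scope ring_scope.
Local Open Scope ereal_scope.

(** * Real numbers between extended reals *)

Lemma lte_dense (R : realType) (x y : \bar R) : x < y ->
  exists2 e : R, x < e%:E & e%:E < y.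
Proof.
case: x y => [x||] [y||]//; rewrite ?lte_fin => xy.
- by exists ((x + y) / 2)%R; rewrite lte_fin; lra.
- by exists (x + 1)%R; rewrite ?ltry// lte_fin; lra.
- by exists (y - 1)%R; rewrite ?ltNyr// lte_fin; lra.
- by exists 0%R; rewrite ?ltry ?ltNyr.
Qed.

(** Each finite summand gives up half of the slack [x + y - a]; an infinite one absorbs any deficit.
    Infinite values in the superadditivity of lower limits are thus dealt with here. *)
Lemma lteD_split (R : realType) (a : R) (x y : \bar R) : -oo < x -> -oo < y ->
  a%:E < x + y -> exists b c : R, [/\ b%:E < x, c%:E < y & (a <= b + c)%R].
Proof.
case: x => [x||]//; case: y => [y||]//; rewrite ?lte_fin => _ _ axy.
- exists (x - (x + y - a) / 2)%R, (y - (x + y - a) / 2)%R.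
  by rewrite !lte_fin; split; lra.
- by exists (x - 1)%R, (a - x + 1)%R; rewrite !lte_fin ltry; split=> //; lra.
- by exists (a - y + 1)%R, (y - 1)%R; rewrite !lte_fin ltry; split=> //; lra.
- by exists a, 0%R; rewrite !ltry; split=> //; lra.
Qed.

(** * Calculus of lower limits along a filter *)

Section LowerLimits.
Context {R : realType} {T : choiceType} {X : filteredType T}.
Variables (F : set_system X).
Context {FF : Filter F}.
Implicit Types (h k : X -> \bar R) (a l : \bar R).

Lemma lt_limf_einf h a : a < limf_einf h F -> \forall x \near F, a < h x.
Proof.
rewrite limf_einfE => /ereal_sup_gt[_ [V FV <-]] aV.
apply: filterS FV => x Vx; apply: lt_le_trans aV _.
by apply: ereal_inf_lbound; exists x.
Qed.

Lemma limf_einf_ge_near h a :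
  (\forall x \near F, a <= h x) -> a <= limf_einf h F.
Proof.
move=> ah; rewrite limf_einfE; apply: le_ereal_sup_tmp.
exists (ereal_inf (h @` [set x | a <= h x])).
  by exists [set x | a <= h x].
by apply: le_ereal_inf_tmp => _ [x ahx <-].
Qed.

(** Testing against real thresholds only keeps the later estimates free of case distinctions on
    infinite values. *)
Lemma limf_einf_geP h l :
  (forall e : R, e%:E < l -> \forall x \near F, e%:E <= h x) <->
  l <= limf_einf h F.
Proof.
split=> [lh|lh e el]; last first.
  by near do apply: ltW; exact: lt_limf_einf (lt_le_trans el lh).
rewrite leNgt; apply/negP => hl.
have [e he el] := lte_dense hl.
by have := limf_einf_ge_near (lh _ el); rewrite leNgt he.
Unshelve. all: by end_near.
Qed.

Lemma cvg_limf_einf_ge h l : h @ F --> l -> l <= limf_einf h F.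
Proof.
move=> hl; apply/limf_einf_geP => e el.
have lel : \forall y \near l, e%:E <= y.
  by apply: filterS (open_ereal_gt' el) => y /ltW.
exact: hl lel.
Qed.

Lemma eq_near_limf_einf h k :
  (\forall x \near F, h x = k x) -> limf_einf h F = limf_einf k F.
Proof.
move=> hk; apply/eqP; rewrite eq_le; apply/andP; split;
  apply/limf_einf_geP => e /lt_limf_einf eh;
  apply: filterS2 hk eh => x -> /ltW //.
Qed.

Lemma limf_einfD h k : -oo < limf_einf h F -> -oo < limf_einf k F ->
  limf_einf h F + limf_einf k F <= limf_einf (h \+ k) F.
Proof.
move=> h_gt k_gt; apply/limf_einf_geP => e.
move=> /(lteD_split h_gt k_gt)[b [c [/lt_limf_einf bh /lt_limf_einf ck ebc]]].
apply: filterS2 bh ck => x bhx ckx.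
by apply: (@le_trans _ _ (b%:E + c%:E)); rewrite ?lee_fin// leeD// ltW.
Qed.

Lemma limf_einf_ge0 h : (forall x, 0 <= h x) -> 0 <= limf_einf h F.
Proof. by move=> h0; apply: limf_einf_ge_near; apply: nearW. Qed.

Lemma limf_einf_sum (I : Type) (s : seq I) (P : pred I) (h : I -> X -> \bar R) :
  (forall i x, 0 <= h i x) ->
  \sum_(i <- s | P i) limf_einf (h i) F <=
  limf_einf (fun x => \sum_(i <- s | P i) h i x) F.
Proof.
move=> h0; elim: s => [|i s IH].
  rewrite big_nil; apply: limf_einf_ge0 => x; exact: sume_ge0.
rewrite big_cons; under [in leRHS]eq_fun do rewrite big_cons.
case: (P i) => //; apply: le_trans (limf_einfD _ _).
- exact: leeD.
- exact: lt_le_trans (limf_einf_ge0 (h0 i)).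
- by apply: lt_le_trans (limf_einf_ge0 _) => // x; apply: sume_ge0.
Qed.

Lemma limf_einfZ (r : R) h : (0 < r)%R ->
  r%:E * limf_einf h F <= limf_einf (fun x => r%:E * h x) F.
Proof.
move=> r0; apply/limf_einf_geP => e.
rewrite muleC -lte_pdivrMr// -EFinM => /lt_limf_einf.
apply: filterS => x /ltW; rewrite EFinM lee_pdivrMr//.
by rewrite muleC.
Qed.

(** The power is increasing on nonnegative values, so a threshold [e > 0] below the left side is the
    [p]-th power of a threshold below the lower limit of [h]. *)
Lemma limf_einf_poweR (p : R) h : (0 < p)%R -> (forall x, 0 <= h x) ->
  limf_einf h F `^ p <= limf_einf (fun x => h x `^ p) F.
Proof.
move=> p0 h0; apply/limf_einf_geP => e ehp.
have [e0|e0] := leP e 0%R.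
  apply: nearW => x; apply: le_trans (poweR_ge0 _ _); by rewrite lee_fin.
have eK : e%:E = (e `^ p^-1)%:E `^ p.
  by rewrite poweR_EFin -powRrM mulVf ?gt_eqF// powRr1// ltW.
have e1 : (e `^ p^-1)%:E < limf_einf h F.
  rewrite ltNge; apply/negP => he; move: ehp; rewrite ltNge eK => /negP; apply.
  apply: gt0_ler_poweR => //; rewrite ?in_itv/= ?leey ?andbT ?lee_fin ?powR_ge0//.
    exact: ltW.
  exact: limf_einf_ge0.
apply: filterS (lt_limf_einf e1) => x ex; rewrite eK.
apply: gt0_ler_poweR => //; rewrite ?in_itv/= ?leey ?andbT ?lee_fin ?powR_ge0//.
  exact: ltW.
exact: ltW.
Qed.

End LowerLimits.

(** * The Euclidean norm and compactness of its unit sphere *)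

Section EuclidNorm.
Context {R : realType} {n : nat}.
Implicit Types x u : 'rV[R]_n.

Lemma euclid_norm_ge0 x : (0 <= euclid_norm x)%R.
Proof. exact: sqrtr_ge0. Qed.

Lemma euclid_norm_sqr x : (euclid_norm x ^+ 2 = \sum_(i < n) x ord0 i ^+ 2)%R.
Proof. by rewrite sqr_sqrtr// sumr_ge0// => i _; exact: sqr_ge0. Qed.

Lemma ler_coord_euclid_norm x i : (`|x ord0 i| <= euclid_norm x)%R.
Proof.
rewrite -ler_sqr ?nnegrE ?euclid_norm_ge0// euclid_norm_sqr -normrX.
rewrite ger0_norm ?sqr_ge0// (bigD1 i)//= lerDl.
by apply: sumr_ge0 => j _; exact: sqr_ge0.
Qed.

Lemma euclid_norm0 : euclid_norm (0 : 'rV[R]_n) = 0%R.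
Proof.
rewrite /euclid_norm big1 ?sqrtr0// => i _.
by rewrite mxE expr0n.
Qed.

Lemma euclid_norm_eq0 x : (euclid_norm x == 0%R) = (x == 0%R).
Proof.
apply/eqP/eqP => [x0|->]; last exact: euclid_norm0.
apply/rowP => i; rewrite mxE; apply/eqP; rewrite -normr_le0 -x0.
exact: ler_coord_euclid_norm.
Qed.

Lemma euclid_normZ (t : R) x : (0 <= t)%R ->
  euclid_norm (t *: x)%R = (t * euclid_norm x)%R.
Proof.
move=> t0; rewrite /euclid_norm.
under eq_bigr do rewrite mxE exprMn.
by rewrite -mulr_sumr sqrtrM ?sqr_ge0// sqrtr_sqr ger0_norm.
Qed.

Lemma ler_norm_euclid_norm x : (`|x| <= euclid_norm x)%R.
Proof.
rewrite [leLHS]/Num.norm/= mx_normrE; apply/bigmax_leP; split=> [|[i j] _ /=].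
  exact: euclid_norm_ge0.
by rewrite ord1; exact: ler_coord_euclid_norm.
Qed.

Lemma euclid_norm_continuous : continuous (@euclid_norm R n).
Proof.
move=> x; apply: (@continuous_comp _ _ _
  (fun y : 'rV[R]_n => \sum_(i < n) y ord0 i ^+ 2)%R); last exact: sqrt_continuous.
apply: (@cvg_big _ _ _ _ _ _ _ (nbhs x)) => [|i _]; first exact: add_continuous.
by apply: cvgM; exact: coord_continuous.
Qed.

(** Heine-Borel: boundedness refers to the sup norm, which the Euclidean norm dominates. *)
Lemma compact_euclid_sphere : compact [set u : 'rV[R]_n | euclid_norm u = 1%R].
Proof.
apply: bounded_closed_compact.
  exists 1%R; split=> // M M1 u /= u1.
  by rewrite (le_trans (ler_norm_euclid_norm u))// u1 ltW.
have -> : [set u : 'rV[R]_n | euclid_norm u = 1%R] =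
  @euclid_norm R n @^-1` [set y | y = 1%R] by [].
apply: preimage_closed; last exact: closed_eq.
by move=> u _; exact: euclid_norm_continuous.
Qed.

End EuclidNorm.

(** * Sharp minimality in terms of difference quotients *)

Section SharpMinimizers.
Context {R : realType} {n : nat}.
Variables (q : R) (h : 'rV[R]_n -> \bar R) (xbar : 'rV[R]_n).
Hypothesis q_gt0 : (0 < q)%R.

Lemma sharp_minimizer_of_subderivative_gt0 :
  h xbar \is a fin_num ->
  (forall u, euclid_norm u = 1%R -> 0 < subderivative q h xbar u) ->
  sharp_minimizer q h xbar.
Proof.
move=> h_fin h_gt0; split; first by rewrite /eff_domain/= ltey_eq h_fin.
(* The parameter is a pair of a growth constant and a step length, both tending to 0 from the right.
   Shrinking the constant along with the step makes a single one serve all directions. *)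
have /compact_near_coveringP/(_ (R * R)%type
    (filter_prod (0%R : R)^'+ (0%R : R)^'+)
    (fun i u => (i.1 * i.2 `^ q)%:E <= h (xbar + i.2 *: u)%R - h xbar)) :=
  @compact_euclid_sphere R n.
case=> [u u1|[A B] /= [A0 B0] AB].
  have [e e0 /lt_limf_einf[[U V] /= [Uu V0] UV]] := lte_dense (h_gt0 u u1).
  (* Every constant below [e] works for directions in [U] and steps in [V]. *)
  exists (U, [set i | (i.1 < e)%R /\ V i.2 /\ (0 < i.2)%R]) => /=.
    split=> //; exists ([set t | (t < e)%R], V `&` [set t | (0 < t)%R]) => /=.
      split; first by apply: nbhs_right_lt; rewrite -lte_fin.
      by apply: filterI => //; exact: nbhs_right_gt.
    by move=> [a b] /= [? []].
  move=> [v [a t]] /= [Uv [ae [Vt t0]]].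
  have /= := UV (v, t) (conj Uv Vt).
  have T0 : (0 < t `^ q)%R by exact: powR_gt0.
  rewrite /diff_quotient/= inver gt_eqF// lte_pdivlMr// => /ltW; apply: le_trans.
  by rewrite lee_fin ler_pM2r// ltW.
have [tau [tau0 Atau]] : exists tau : R, (0 < tau)%R /\ A tau.
  near (0%R : R)^'+ => tau; exists tau; split; near: tau => //.
  exact: nbhs_right_gt.
exists tau => //.
have [d /= d0 dB] := B0.
have : \forall x \near xbar, (euclid_norm (x - xbar) < d)%R.
  have : euclid_norm (x - xbar) @[x --> xbar] --> 0%R.
    rewrite -(@euclid_norm0 R n) -(subrr xbar).
    apply: (@continuous_comp _ _ _ (fun x : 'rV[R]_n => x - xbar)%R).
      by apply: continuousB; [exact: cvg_id | exact: cst_continuous].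
    exact: euclid_norm_continuous.
  by move/cvgr_lt; apply.
apply: filterS => x xd.
have [->|xx] := eqVneq x xbar.
  by rewrite !subrr euclid_norm0 powR0 ?gt_eqF// mulr0 subee.
(* Polar decomposition: [x] is reached from [xbar] by a step of length [t] in a unit direction. *)
set t := euclid_norm (x - xbar) in xd *.
have t0 : (0 < t)%R by rewrite lt0r euclid_norm_ge0 euclid_norm_eq0 subr_eq0 xx.
have Bt : B t by apply: dB => //=; rewrite sub0r normrN gtr0_norm.
have u1 : euclid_norm (t^-1 *: (x - xbar))%R = 1%R.
  by rewrite euclid_normZ ?invr_ge0 ?ltW// mulVf// gt_eqF.
have /= := AB (tau, t) (conj Atau Bt) _ u1.
by rewrite scalerA divff ?gt_eqF// scale1r [(xbar + _)%R]addrC subrK.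
Unshelve. all: by end_near.
Qed.

Lemma near_directions (P : set 'rV[R]_n) (u : 'rV[R]_n) :
  (\forall x \near xbar, P x) ->
  \forall ut \near filter_prod (nbhs u) (0%R : R)^'+,
    P (xbar + ut.2 *: ut.1)%R.
Proof.
move=> xbarP.
have : (xbar + ut.2 *: ut.1)%R @[ut --> filter_prod (nbhs u) (0%R : R)^'+] -->
    (xbar + 0 *: u)%R.
  apply: cvgD; first exact: cvg_cst.
  apply: cvgZ; last exact: cvg_fst.
  by apply: cvg_trans cvg_snd _; exact: cvg_within.
by rewrite scale0r addr0; apply.
Qed.

Lemma near_directions_gt0 (u : 'rV[R]_n) :
  \forall ut \near filter_prod (nbhs u) (0%R : R)^'+, (0 < ut.2)%R.
Proof.
exact: (@cvg_snd _ _ (nbhs u) (0%R : R)^'+ _ _ (nbhs_right_gt 0%R)).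
Qed.

(** Directions [v] near [u] are longer than [euclid_norm u / 2], so growth at [xbar + t v] is at
    least [tau (t |u| / 2)^q]; dividing by [t^q] gives the constant. *)
Lemma sharp_minimizer_diff_quotient_ge (u : 'rV[R]_n) :
  sharp_minimizer q h xbar -> u != 0%R ->
  exists2 c : R, (0 < c)%R &
    \forall ut \near filter_prod (nbhs u) (0%R : R)^'+,
      c%:E <= diff_quotient q h xbar ut.
Proof.
move=> [_ [tau tau0 tauP]] u0.
have nu0 : (0 < euclid_norm u)%R.
  by rewrite lt0r euclid_norm_ge0 euclid_norm_eq0 u0.
exists (tau * (euclid_norm u / 2) `^ q)%R.
  by rewrite mulr_gt0// powR_gt0// divr_gt0.
have nearu : \forall v \near u, (euclid_norm u / 2 < euclid_norm v)%R.
  have /cvgr_gt : euclid_norm v @[v --> u] --> euclid_norm u.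
    exact: euclid_norm_continuous.
  by apply; lra.
have nearu' : \forall ut \near filter_prod (nbhs u) (0%R : R)^'+,
    (euclid_norm u / 2 < euclid_norm ut.1)%R.
  exact: (@cvg_fst _ _ (nbhs u) (0%R : R)^'+ _ _ nearu).
apply: filterS3 (near_directions u tauP) nearu' (near_directions_gt0 u).
move=> [v t] /= tauvt uv t0.
have T0 : (0 < t `^ q)%R by exact: powR_gt0.
rewrite /diff_quotient/= inver gt_eqF// lee_pdivlMr// -EFinM.
apply: le_trans tauvt; rewrite [(xbar + _)%R]addrC addrK lee_fin.
have nu2 : (0 <= euclid_norm u / 2)%R by rewrite ltW// divr_gt0.
rewrite -mulrA ler_pM2l// -powRM ?(ltW t0)// mulrC euclid_normZ ?(ltW t0)//.
rewrite ge0_ler_powR ?nnegrE ?mulr_ge0 ?euclid_norm_ge0 ?(ltW t0) ?(ltW q_gt0)//.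
by rewrite ler_pM2l// ltW.
Qed.

End SharpMinimizers.

(** * Quotients of the penalty function and the threshold [rho0] *)

Lemma poweR_div_powR (R : realType) (p q t : R) (x : \bar R) :
  (0 < p)%R -> (0 < t)%R -> 0 <= x ->
  (x / (t `^ (q / p))%:E) `^ p = x `^ p / (t `^ q)%:E.
Proof.
move=> p0 t0 x0; rewrite !inver !gt_eqF ?powR_gt0//.
rewrite poweRM ?lee_fin ?invr_ge0 ?powR_ge0// poweR_EFin.
by rewrite -!powRN -powRrM mulNr divfK ?gt_eqF.
Qed.

Section PenaltyFunction.
Context {R : realType} {n m : nat}.
Variables (p q : R) (f : 'rV[R]_n -> \bar R) (g : 'I_m -> 'rV[R]_n -> \bar R).
Variables (xbar : 'rV[R]_n).
Hypotheses (f_gtNy : forall x, -oo < f x).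
Hypotheses (p_gt0 : (0 < p)%R) (q_gt0 : (0 < q)%R).
Hypotheses (f_dom : eff_domain f xbar) (xbar_feasible : feasible g xbar).

Lemma funepos_feasible i : (g i)^\+ xbar = 0.
Proof. by rewrite funeposE; apply/max_idPr; exact: xbar_feasible. Qed.

Lemma diff_quotient_funepos s i ut :
  diff_quotient s (g i)^\+ xbar ut =
  (g i)^\+ (xbar + ut.2 *: ut.1)%R / (ut.2 `^ s)%:E.
Proof. by rewrite /diff_quotient funepos_feasible sube0. Qed.

Lemma diff_quotient_funepos_ge0 s i ut : 0 <= diff_quotient s (g i)^\+ xbar ut.
Proof.
rewrite diff_quotient_funepos mule_ge0 ?funepos_ge0//.
by rewrite inve_ge0 lee_fin powR_ge0.
Qed.

Lemma penalty_feasible r : penalty p f g r xbar = f xbar.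
Proof.
rewrite /penalty big1 ?mule0 ?adde0// => i _.
by rewrite funepos_feasible poweR0r// gt_eqF.
Qed.

Lemma f_xbar_fin : f xbar \is a fin_num.
Proof. by rewrite fin_real// f_gtNy. Qed.

Lemma diff_quotient_penalty r ut : (0 <= r)%R -> (0 < ut.2)%R ->
  diff_quotient q (penalty p f g r) xbar ut =
  diff_quotient q f xbar ut +
  r%:E * \sum_(i < m) diff_quotient (q / p) (g i)^\+ xbar ut `^ p.
Proof.
move=> r0 t0; under eq_bigr do
  rewrite diff_quotient_funepos poweR_div_powR ?funepos_ge0//.
rewrite -ge0_sume_distrl => [|i _]; last exact: poweR_ge0.
rewrite {1 2}/diff_quotient penalty_feasible /penalty muleA.
set S := \sum_(i < m) _.
have rS0 : 0 <= r%:E * S.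
  by rewrite mule_ge0// sume_ge0// => i _; exact: poweR_ge0.
rewrite addeAC muleDl//.
  by rewrite inver gt_eqF ?powR_gt0.
(* Distributivity needs a sum that is not of the form +oo - oo: [f] avoids -oo, [f xbar] is finite
   and the penalty term is nonnegative. *)
have := f_gtNy (xbar + ut.2 *: ut.1)%R.
by case: (f _) f_xbar_fin (r%:E * S) rS0 => [?||];
  case: (f _) => [?||] // _ [?||].
Qed.

Lemma subderivative_funepos_ge0 s i x : 0 <= subderivative s (g i)^\+ xbar x.
Proof. by apply: limf_einf_ge0 => ut; exact: diff_quotient_funepos_ge0. Qed.

Lemma subderivative_penalty_ge r x : (0 < r)%R ->
  -oo < subderivative q f xbar x ->
  subderivative q f xbar x +
  r%:E * \sum_(i in active g xbar)
           subderivative (q / p) (g i)^\+ xbar x `^ p <=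
  subderivative q (penalty p f g r) xbar x.
Proof.
move=> r0 fx.
rewrite [leRHS](@eq_near_limf_einf _ _ _ _ _ _ (diff_quotient q f xbar \+ fun ut =>
  r%:E * \sum_(i < m) diff_quotient (q / p) (g i)^\+ xbar ut `^ p)); last first.
  by apply: filterS (near_directions_gt0 x) => ut; apply/diff_quotient_penalty/ltW.
apply: le_trans (limf_einfD _ _) => //; last first.
  apply: (@lt_le_trans _ _ 0) => //; apply: limf_einf_ge0 => ut.
  apply: mule_ge0; first by rewrite lee_fin ltW.
  by apply: sume_ge0 => i _; exact: poweR_ge0.
apply: leeD => //; apply: le_trans (limf_einfZ _ r0).
apply: lee_wpmul2l; first by rewrite lee_fin ltW.
apply: le_trans (limf_einf_sum _ _ _) => [|i ut]; last exact: poweR_ge0.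
(* Inactive indices count 0 on the left and a nonnegative lower limit on the right. *)
rewrite big_mkcond/=; apply: lee_sum => i _; case: ifP => _.
  by apply: limf_einf_poweR => // ut; exact: diff_quotient_funepos_ge0.
by apply: limf_einf_ge0 => ut; exact: poweR_ge0.
Qed.

Let S u := \sum_(i in active g xbar) subderivative (q / p) (g i)^\+ xbar u `^ p.

Let S_ge0 u : 0 <= S u.
Proof. by apply: sume_ge0 => i _; exact: poweR_ge0. Qed.

Lemma a_const_ge0 : 0 <= a_const p q f g xbar.
Proof. by apply: le_ereal_inf_tmp => _ [u _ <-]; exact: S_ge0. Qed.

Lemma b_const_le u : euclid_norm u = 1%R ->
  b_const q f xbar <= subderivative q f xbar u.
Proof. by move=> u1; apply: ereal_inf_lbound; exists u. Qed.

(** A point of [Kstar] forces [b_const <= 0]. This makes every [r] above [rho0] positive. *)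
Lemma rho0_ge0 : 0 <= rho0 p q f g xbar.
Proof.
rewrite /rho0; case: asboolP => // -[u [u1 fu0]].
apply: mule_ge0; last by rewrite inve_ge0 a_const_ge0.
by rewrite oppe_ge0 (le_trans (b_const_le u1)).
Qed.

(** If the sum vanished, so would each of its nonnegative terms, and the qualification would make
    the subderivative of [f] positive. *)
Lemma qualification_sum_gt0 u : qualification p q f g xbar -> u != 0%R ->
  subderivative q f xbar u <= 0 -> 0 < S u.
Proof.
move=> qual u0 fu0; rewrite lt0e S_ge0 andbT; apply/eqP => Su0.
move: fu0; rewrite leNgt => /negP; apply; apply: qual => // i ai.
apply: (@poweR_eq0_eq0 _ _ p); first exact: subderivative_funepos_ge0.
apply/eqP; rewrite eq_le poweR_ge0 andbT -Su0 /S (bigD1 i)//= leeDl//.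
by apply: sume_ge0 => j _; exact: poweR_ge0.
Qed.

(* No attainment of the infima is needed: if a_const = 0 and b_const < 0 then
   rho0 = +oo, and if b_const = 0 then the qualification alone suffices. *)
Lemma lt_rho0_subderivative_gt0 r u :
  proper_fun (subderivative q f xbar) -> qualification p q f g xbar ->
  rho0 p q f g xbar < r%:E -> euclid_norm u = 1%R ->
  0 < subderivative q f xbar u + r%:E * S u.
Proof.
move=> [f_proper _] qual rho0r u1.
have r0 : (0 < r)%R by rewrite -lte_fin (le_lt_trans rho0_ge0).
have [fu0|fu0] := ltP 0 (subderivative q f xbar u).
  by rewrite lte_paddr// mule_ge0 ?S_ge0// lee_fin ltW.
have u0 : u != 0%R by rewrite -euclid_norm_eq0 u1 oner_eq0.
have Su0 := qualification_sum_gt0 qual u0 fu0.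
have Ku : Kstar q f xbar u by [].
have aS : a_const p q f g xbar <= S u by apply: ereal_inf_lbound; exists u.
have bf := b_const_le u1.
move: rho0r; rewrite /rho0 asboolT; last by exists u.
move: (S u) (f_proper u) Su0 aS fu0 bf (a_const_ge0).
move: (a_const _ _ _ _ _) (b_const _ _ _) (subderivative _ _ _ _) => a b v.
(* For [s = +oo] the sum is +oo; otherwise [a <= s] makes [a] finite. *)
case=> [s||]//; case: v => [v||]//; rewrite ?gt0_muley ?lte_fin ?addey ?ltry//.
case: a => [a||]//; rewrite !lee_fin => _ s0 as_ v0 bv a0.
case: b bv => [b||]// bv; rewrite inver; case: eqVneq => [a_eq0|a_neq0];
  rewrite /= -?EFinM -?EFinD ?lte_fin.
(* For [a = 0] the inverse is +oo, so [b < 0] would give [rho0 = +oo]; otherwise [v = 0] and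
   [r s > 0] suffices. *)
- rewrite lee_fin in bv; have [b0|b0] := ltP b 0%R.
    by rewrite gt0_muley ?lte_fin ?oppr_gt0.
  by move=> _; have := mulr_gt0 r0 s0; lra.
(* Here [v + r s >= b + r a > 0]. *)
- rewrite lee_fin in bv; have a_gt0 : (0 < a)%R by rewrite lt0r a_neq0.
  rewrite ltr_pdivrMr// => bra; have := ler_wpM2l (ltW r0) as_; lra.
(* The two remaining cases have [b = -oo], hence [rho0 = +oo], contrary to [rho0 < r]. *)
- by rewrite mulyy.
- by rewrite gt0_mulye// lte_fin invr_gt0 lt0r a_neq0.
Qed.

Lemma sharp_minimizer_penalty r :
  proper_fun (subderivative q f xbar) -> qualification p q f g xbar ->
  rho0 p q f g xbar < r%:E -> sharp_minimizer q (penalty p f g r) xbar.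
Proof.
move=> f_proper qual rho0r.
apply: sharp_minimizer_of_subderivative_gt0 => // [|u u1].
  by rewrite penalty_feasible f_xbar_fin.
apply: lt_le_trans (lt_rho0_subderivative_gt0 f_proper qual rho0r u1) _.
apply: subderivative_penalty_ge.
  by rewrite -lte_fin (le_lt_trans rho0_ge0).
by rewrite ltNye f_proper.1.
Qed.

(** A zero lower limit gives small quotients only at some points of each filter set, so [P] has to
    be built into the choice. For an inactive constraint the quotient is 0 near [xbar]. *)
Lemma funepos_quotient_frequently_lt s i u (e : R)
    (P : set ('rV[R]_n * R)%type) :
  inactive_locally_satisfied g xbar ->
  (i \in active g xbar -> subderivative s (g i)^\+ xbar u = 0) ->
  (0 < e)%R -> (\forall ut \near filter_prod (nbhs u) (0%R : R)^'+, P ut) ->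
  exists2 ut, P ut & diff_quotient s (g i)^\+ xbar ut < e%:E.
Proof.
move=> inact act e0 nearP.
have [ai|] := boolP (i \in active g xbar).
  apply: contrapT => noP; have := act ai; apply/eqP; rewrite gt_eqF//.
  apply: (@lt_le_trans _ _ e%:E); first by rewrite lte_fin.
  apply: limf_einf_ge_near; apply: filterS nearP => ut Put.
  by rewrite leNgt; apply/negP => kut; apply: noP; exists ut.
rewrite inE => gi; have gi_lt0 : g i xbar < 0.
  by rewrite lt_neqAle gi; exact: xbar_feasible.
have [ut [Put gut]] := @filter_ex _ (filter_prod (nbhs u) (0%R : R)^'+) _ _
  (filterI nearP (near_directions u (inact i gi_lt0))).
exists ut => //.
by rewrite diff_quotient_funepos funeposE (max_idPr gut) mul0e lte_fin.
Qed.

End PenaltyFunction.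

(** Points with a small constraint quotient are only frequent, and several constraints might not
    share them; hence a single constraint. The quotients of [f] have a full limit, so they are
    controlled at those points too. *)
Lemma penalty_sharp_qualification (R : realType) (n : nat) (p q r : R)
    (f : 'rV[R]_n -> \bar R) (g : 'I_1 -> 'rV[R]_n -> \bar R)
    (xbar : 'rV[R]_n) :
  (forall x, -oo < f x) -> (0 < p)%R -> (0 < q)%R -> (0 < r)%R ->
  eff_domain f xbar -> feasible g xbar ->
  hadamard_differentiable q f xbar -> inactive_locally_satisfied g xbar ->
  sharp_minimizer q (penalty p f g r) xbar -> qualification p q f g xbar.
Proof.
move=> f_gtNy p0 q0 r0 f_dom feas f_diff inact sharp x x0 act.
rewrite ltNge; apply/negP => fx0.
have [c c0 sharpx] := sharp_minimizer_diff_quotient_ge q0 sharp x0.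
have [l fl] := f_diff x.
have l0 : l%:E <= 0 by apply: le_trans fx0; exact: cvg_limf_einf_ge.
have near_f : \forall ut \near filter_prod (nbhs x) (0%R : R)^'+,
    diff_quotient q f xbar ut < (c / 2)%:E.
  have lc : \forall y \near l%:E, y < (c / 2)%:E.
    by apply: open_ereal_lt'; rewrite (le_lt_trans l0)// lte_fin divr_gt0.
  exact: fl lc.
(* Chosen so that [r * e^p = c / 2]: the [f] part and the penalty part together then stay below
   [c]. *)
set e := ((c / (2 * r)) `^ p^-1)%R.
have e0 : (0 < e)%R by rewrite powR_gt0// divr_gt0// mulr_gt0.
have [ut [[penut t0] fut] gut] := funepos_quotient_frequently_lt feas inact
  (act ord0) e0 (filterI (filterI sharpx (near_directions_gt0 x)) near_f).
move: penut; rewrite leNgt => /negP; apply.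
rewrite diff_quotient_penalty// ?ltW// big_ord1.
have -> : c%:E = (c / 2)%:E + (c / 2)%:E by rewrite -EFinD -splitr.
have ge0 : 0 <= diff_quotient (q / p) (g ord0)^\+ xbar ut.
  exact: diff_quotient_funepos_ge0.
move: gut ge0; case: (diff_quotient _ (g ord0)^\+ _ _) => [y||]//.
rewrite lte_fin lee_fin => ye y0.
apply: lte_leD => //.
rewrite poweR_EFin -EFinM lee_fin -ler_pdivlMl//.
have -> : (r^-1 * (c / 2) = e `^ p)%R.
  rewrite /e -powRrM mulVf ?gt_eqF// powRr1.
    by field; rewrite gt_eqF.
  by rewrite divr_ge0 ?mulr_ge0// ltW.
apply: ge0_ler_powR; rewrite ?nnegrE//; exact: ltW.
Qed.

Theorem theorem5p1 (R : realType) (n m : nat) (p q : R)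
    (f : 'rV[R]_n -> \bar R) (g : 'I_m -> 'rV[R]_n -> \bar R)
    (xbar : 'rV[R]_n)
    (f_gtNy : forall x, -oo < f x) (g_gtNy : forall i x, -oo < g i x)
    (p_gt0 : (0 < p)%R) (q_gt0 : (0 < q)%R)
    (f_dom : eff_domain f xbar) (g_dom : forall i, eff_domain (g i) xbar)
    (xbar_feasible : feasible g xbar) :
  (proper_fun (subderivative q f xbar) ->
   qualification p q f g xbar ->
   forall r : R, rho0 p q f g xbar < r%:E ->
     sharp_minimizer q (penalty p f g r) xbar)
  /\
  (hadamard_differentiable q f xbar ->
   m = 1%N ->
   inactive_locally_satisfied g xbar ->
   (exists2 r : R, (0 < r)%R & sharp_minimizer q (penalty p f g r) xbar) ->
   qualification p q f g xbar).
Proof.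
split=> [f_proper qual r rho0r|f_diff m1 inact [r r0 sharp]].
  exact: sharp_minimizer_penalty.
by subst m; exact: penalty_sharp_qualification r0 _ _ f_diff inact sharp.
Qed.
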